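(* Let $f,h_1,\ldots,h_{m_1},g_1,\ldots,g_{m_2}\in\mathbb{R}[x_1,\ldots,x_n]$ and let $S=\{x\in\mathbb{R}^n:\ h_1(x)=\cdots=h_{m_1}(x)=0,\ g_1(x)\ge0,\ldots,g_{m_2}(x)\ge0\}$. (a) If $m_1>n$ and $Res(h_{i_1},\ldots,h_{i_{n+1}})\ne0$ for some $\{i_1,\ldots,i_{n+1}\}\subset[m_1]$, then $S=\emptyset$. (b) If $m_1\le n$ and for every $\{j_1,\ldots,j_{n-m_1+1}\}\subset[m_2]$ $$Res(h_1,\ldots,h_{m_1},g_{j_1},\ldots,g_{j_{n-m_1+1}})\ne0,$$ then for any $u\in S$, at most $n-m_1$ of $g_1(u),\ldots,g_{m_2}(u)$ vanish. (c) If $m_1\le n$ and for every $\{j_1,\ldots,j_k\}\subset[m_2]$ with $k\le n-m_1$ $$\Delta(h_1,\ldots,h_{m_1},g_{j_1},\ldots,g_{j_k})\ne0,$$ then for every $J=\{j_1,\ldots,j_k\}\subset[m_2]$ with $k\le n-m_1$ the variety $V(h,g_J)=\{x\in\mathbb{C}^n: h_1(x)=\cdots=h_{m_1}(x)=0,\ g_j(x)=0\ \forall j\in J\}$ is nonsingular (the Jacobian of its defining polynomials $h_1,\ldots,h_{m_1},g_{j_1},\ldots,g_{j_k}$ has full rank at every point of $V(h,g_J)$). (d) Suppose $S$ is closed at $\infty$ and $f\in B_d(S)$, where $d=\deg f$. If the resultant of any $n$ of the forms $h_i^{hom},g_j^{hom}$ ($i\in[m_1]$, $j\in[m_2]$)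 is nonzero (a condition only when $m_1+m_2\ge n$), and for every $\{j_1,\ldots,j_k\}\subset[m_2]$ with $k\le n-m_1-1$ $$\Delta(f^{hom},h_1^{hom},\ldots,h_{m_1}^{hom},g_{j_1}^{hom},\ldots,g_{j_k}^{hom})\ne0,$$ then there exists $v\in S$ such that $f(v)=f_{min}$, where $f_{min}$ is the minimum (infimum) of $f$ on $S$. (e) If $f\in B_d(\mathbb{R}^n)$ (with $d=\deg f$) and $\Delta(f^{hom})\ne0$, then the minimum of $f(x)$ in $\mathbb{R}^n$ is achievable (attained).
   Context: $[k]=\{1,\ldots,k\}$. For a polynomial $p$, $p^{hom}$ denotes its homogeneous part of highest degree, and $\tilde p(\tilde x)=x_0^{\deg(p)}p(x/x_0)$ its homogenization, $\tilde x=(x_0,x_1,\ldots,x_n)$. $B_d(S)=\{f\in\mathbb{R}[x]:\ \deg f\le d,\ \inf_{u\in S}f(u)>-\infty\}$. $S^{prj}=\{\tilde x\in\mathbb{R}^{n+1}:\ \tilde h_1(\tilde x)=\cdots=\tilde h_{m_1}(\tilde x)=0,\ \tilde g_1(\tilde x)\ge0,\ldots,\tilde g_{m_2}(\tilde x)\ge0\}$. The set $S$ (with this description) is closed at $\infty$ if $S^{prj}\cap\{x_0\ge0\}=\mathrm{closure}(S^{prj}\cap\{x_0>0\})$. Resultants: for $n$ forms $f_1,\ldots,f_n$ in $n$ variables, $Res(f_1,\ldots,f_n)$ is the polynomial in their coefficients with $Res(f_1,\ldots,f_n)=0$ if and only if there is $0\ne u\in\mathbb{C}^n$ with $f_1(u)=\cdots=f_n(u)=0$.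 For $n+1$ (not necessarily homogeneous) polynomials $f_0,\ldots,f_n$ in $n$ variables, $Res(f_0,\ldots,f_n):=Res(\tilde f_0,\ldots,\tilde f_n)$. Discriminants: for forms $f_1,\ldots,f_t$ in $n$ variables, $\Delta(f_1,\ldots,f_t)$ is the polynomial in their coefficients with $\Delta(f_1,\ldots,f_t)=0$ if and only if there is $0\ne u\in\mathbb{C}^n$ with $f_1(u)=\cdots=f_t(u)=0$ at which the matrix $[\nabla f_1(u)\ \cdots\ \nabla f_t(u)]$ does not have full (column) rank. For a single form $f$, $\Delta(f)=0$ if and only if $\nabla f(u)=0$ for some $0\ne u\in\mathbb{C}^n$. For nonhomogeneous polynomials $f_1,\ldots,f_t$ in $n$ variables with $t\le n$, $\Delta(f_1,\ldots,f_t):=\Delta(\tilde f_1,\ldots,\tilde f_t)$ (forms in $n+1$ variables). Only these vanishing characterizations matter: each condition ''$\Delta\neq 0$'' is to be read as nonexistence of such a point $u$. The condition for an empty list of polynomials is vacuous.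
   Formalization: In (d), S is additionally assumed nonempty; without this (d) fails, e.g. for n=1, no h, g_1=-1, f=x, where S is empty and all the other hypotheses hold. *)

(* Defs.v *)
From HB Require Import structures.
(* multinomials must be imported before mathcomp-analysis: in the other order
   their notations clash. *)
From mathcomp Require Import all_boot all_order all_algebra.
From mathcomp Require Import mpoly complex.
From mathcomp Require Import all_classical all_reals ereal topology normedtype.
Set Implicit Arguments.
Unset Strict Implicit.
Unset Printing Implicit Defensive.
Import Order.TTheory GRing.Theory Num.Theory.
Import numFieldNormedType.Exports.
Local Open Scope classical_set_scope.
Local Open Scope ring_scope.

Section Homogenization.
Context {R : comNzRingType} {n : nat}.
Implicit Type p : {mpoly R[n]}.

(* Total degree, with the convention that the zero polynomial has degree 0. *)
Definition tdeg p : nat := (msize p).-1.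

Definition topform p : {mpoly R[n]} := pihomog mdeg (tdeg p) p.

(* The variable x_0 has index ord0, and x_i (1 <= i <= n) becomes
   'X_(lift ord0 i). *)
Definition homogenize p : {mpoly R[n.+1]} :=
  \sum_(m <- msupp p)
    p@_m *: ('X_ord0 ^+ (tdeg p - mdeg m) * \prod_(i < n) 'X_(lift ord0 i) ^+ m i).

End Homogenization.

Lemma homogenizeE (K : fieldType) (n : nat) (p : {mpoly K[n]})
    (x : 'I_n.+1 -> K) : x ord0 != 0 ->
  (homogenize p).@[x] =
    x ord0 ^+ tdeg p * p.@[fun i => x (lift ord0 i) / x ord0].
Proof.
move=> x0; rewrite /homogenize [p.@[_]]mevalE raddf_sum /= mulr_sumr.
rewrite !big_seq; apply: eq_bigr => m m_in.
have le_m : (mdeg m <= tdeg p)%N.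
  by rewrite -ltnS; apply: leq_trans (msize_mdeg_lt m_in) (leqSpred _).
rewrite mevalZ mevalM rmorphXn /= mevalXU rmorph_prod /= [RHS]mulrCA.
congr (_ * _).
under eq_bigr do rewrite rmorphXn /= mevalXU.
under [in RHS]eq_bigr do rewrite expr_div_n.
rewrite -[in RHS](subnK le_m) exprD -mulrA; congr (_ * _).
rewrite mdegE expr_sum -big_split /=; apply: eq_bigr => i _.
by rewrite mulrC divfK // expf_neq0.
Qed.

Section Elimination.
Context {R : realType} {n : nat}.
Implicit Types (fs : seq {mpoly R[n]}) (u : 'rV[R[i]]_n).

Definition complexify (p : {mpoly R[n]}) : {mpoly R[i][n]} :=
  map_mpoly (real_complex R) p.

Definition common_zero fs u : Prop :=
  forall p, p \in fs -> (complexify p).@[u ord0] = 0.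

(* The j-th column is the gradient of the j-th polynomial. *)
Definition gradmx fs u : 'M[R[i]]_(n, size fs) :=
  \matrix_(i < n, j < size fs) ((complexify fs`_j)^`M(i)).@[u ord0].

Definition full_column_rank fs u : Prop := \rank (gradmx fs u) = size fs.

(* Non-vanishing of the resultant of n forms in n variables; only used on
   lists of n forms. *)
Definition Res_neq0 fs : Prop :=
  ~ exists u, u != 0 /\ common_zero fs u.

(* Non-vanishing of the discriminant of a list of forms.  For a single form the
   criterion is the vanishing of the gradient alone; by Euler's identity the
   form then vanishes as well, unless it has degree 0. *)
Definition Disc_neq0 fs : Prop :=
  match fs with
  | [::] => True
  | [:: f] => ~ exists u, u != 0 /\
                forall i : 'I_n, ((complexify f)^`M(i)).@[u ord0] = 0
  | _ => ~ exists u, [/\ u != 0, common_zero fs u & ~ full_column_rank fs u]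
  end.

Definition nonsingular_variety fs : Prop :=
  forall u, common_zero fs u -> full_column_rank fs u.

End Elimination.

(* Resultant and discriminant of non-homogeneous polynomials. *)
Definition hRes_neq0 {R : realType} {n : nat} (fs : seq {mpoly R[n]}) : Prop :=
  Res_neq0 [seq homogenize p | p <- fs].

Definition hDisc_neq0 {R : realType} {n : nat} (fs : seq {mpoly R[n]}) : Prop :=
  Disc_neq0 [seq homogenize p | p <- fs].

Section Optimization.
Context {R : realType} {n : nat}.
Implicit Types (f : {mpoly R[n]}) (S : set 'rV[R]_n).

Definition semialg {m1 m2 : nat} (h : 'I_m1 -> {mpoly R[n]})
    (g : 'I_m2 -> {mpoly R[n]}) : set 'rV[R]_n :=
  [set x | (forall i, (h i).@[x ord0] = 0) /\ (forall j, 0 <= (g j).@[x ord0])].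

(* The infimum is taken in the extended reals (it is +oo when S is empty). *)
Definition fmin f S : \bar R := ereal_inf [set (f.@[u ord0])%:E | u in S].

Definition B (d : nat) S : set {mpoly R[n]} :=
  [set f | (tdeg f <= d)%N /\ (-oo < fmin f S)%E].

Definition attains_min f S : Prop :=
  exists v, S v /\ (f.@[v ord0])%:E = fmin f S.

End Optimization.

Section ClosedAtInfinity.
Context {R : realType} {n m1 m2 : nat}.
Variables (h : 'I_m1 -> {mpoly R[n]}) (g : 'I_m2 -> {mpoly R[n]}).

Definition Sprj : set 'rV[R]_n.+1 :=
  semialg (fun i => homogenize (h i)) (fun j => homogenize (g j)).

Definition closed_at_infty : Prop :=
  Sprj `&` [set x | 0 <= x ord0 ord0] =
  closure (Sprj `&` [set x | 0 < x ord0 ord0]).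

End ClosedAtInfinity.

(* Main.v *)
(* (a)-(c): a point u of affine space gives the zero (1, u) of the
   homogenizations, and by Euler's identity the Jacobian there has the same rank
   as the affine one.

   (d): minimize f~ - (inf f) x_0^d over the unit sphere of the projective cone
   of S in the half-space x_0 >= 0.  It is nonnegative there because S is closed
   at infinity, and its minimum w is a zero.  If w_0 > 0, then w dehomogenizes
   to a minimizer of f.  Otherwise w = (0, v) with f^hom(v) = 0; the resultants
   bound the number of constraints active at v, so the discriminants make the
   gradients of f^hom and of the active constraints independent at v.  The map
   they form is then locally onto (a Newton contraction), so some v' near v
   satisfies all constraints with f^hom(v') < 0, contradicting nonnegativity at
   (0, v').  The case d = 0 is trivial.

   (e) is (d) without constraints. *)
Require Import Defs.
From HB Require Import structures.
From mathcomp Require Import all_boot all_order all_algebra.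
From mathcomp Require Import mpoly complex.
From mathcomp Require Import all_classical all_reals ereal topology normedtype.
From mathcomp Require Import derive ring lra.
Set Implicit Arguments.
Unset Strict Implicit.
Unset Printing Implicit Defensive.
Import Order.TTheory GRing.Theory Num.Theory.
Import numFieldNormedType.Exports.
Local Open Scope classical_set_scope.
Local Open Scope ring_scope.

(** * Polynomial induction, formal derivatives and Euler's identity *)

Section MPolyAlgebra.
Context {R : comNzRingType} {n : nat}.

(** Constants and variables generate the polynomial ring under sums and products. This suits
    properties that pass through both operations, such as compatibility with evaluation, derivation
    rules and continuity. *)
Lemma mpoly_alg_ind (P : {mpoly R[n]} -> Prop) :
    (forall c, P c%:MP) -> (forall i, P 'X_i) ->
    (forall p q, P p -> P q -> P (p + q)) ->
    (forall p q, P p -> P q -> P (p * q)) ->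
  forall p, P p.
Proof.
move=> PC PX PD PM p; rewrite (mpolyE p).
elim/big_ind: _ => [|//|m _]; first exact: PC.
rewrite -mul_mpolyC; apply: (PM _ _ (PC _)); rewrite mpolyXE_id.
elim/big_ind: _ => [|//|i _]; first exact: PC.
by elim: (m i) => [|k IHk]; [exact: PC | rewrite exprS; exact: PM].
Qed.

Lemma mderivXU (i j : 'I_n) : ('X_j)^`M(i) = (i == j)%:R :> {mpoly R[n]}.
Proof.
rewrite mderivX mnm1E eq_sym; case: eqVneq => [->|_]; last by rewrite scale0r.
rewrite scale1r (_ : (U_(j) - U_(j))%MM = 0%MM) ?mpolyX0 //.
by apply/mnmP => k; rewrite mnmBE subnn mnm0E.
Qed.

Lemma euler_mderiv (d : nat) (q : {mpoly R[n]}) (x : 'I_n -> R) :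
  q \is d.-homog for mdeg ->
  \sum_(i < n) x i * (q^`M(i)).@[x] = d%:R * q.@[x].
Proof.
move=> /dhomogP q_hom; rewrite [in RHS](mpolyE q) raddf_sum mulr_sumr /=.
have dq i : q^`M(i) = \sum_(m <- msupp q) (q@_m *: 'X_[m])^`M(i).
  by rewrite -(raddf_sum (mderiv i)) -mpolyE.
under eq_bigr => i _ do rewrite dq raddf_sum mulr_sumr /=.
rewrite exchange_big /= big_seq [RHS]big_seq; apply: eq_bigr => m /q_hom /= <-.
under eq_bigr => i _ do rewrite mderivZ mevalZ mulrCA.
rewrite -mulr_sumr mevalZ [RHS]mulrCA; congr (_ * _).
rewrite mdegE natr_sum mulr_suml; apply: eq_bigr => i _.
rewrite mderivX mevalZ mulrCA -[x i](mevalXU x i) -mevalM.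
(* When [m i = 0] the truncated exponent [m - U_(i)] is wrong, but the factor [m i] kills the
   term. *)
case: (posnP (m i)) => [->|mi_gt0]; first by rewrite !mul0r.
congr (_ * _.@[_]); rewrite -mpolyXD addmC submK //.
by apply/mnm_lepP => j; rewrite mnm1E; case: eqP => // <-.
Qed.

End MPolyAlgebra.

(** * Change of coefficients *)

Section MapMPoly.
Context {F K : comNzRingType} (phi : {rmorphism F -> K}) {n : nat}.

Lemma meval_map_mpoly (p : {mpoly F[n]}) (x : 'I_n -> F) :
  (map_mpoly phi p).@[phi \o x] = phi p.@[x].
Proof.
move: p; apply: mpoly_alg_ind => [c|i|p q IHp IHq|p q IHp IHq].
- by rewrite map_mpolyC !mevalC.
- by rewrite map_mpolyX !mevalXU.
- by rewrite !rmorphD /= IHp IHq.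
- by rewrite !rmorphM /= IHp IHq.
Qed.

Lemma mderiv_map_mpoly (p : {mpoly F[n]}) (i : 'I_n) :
  (map_mpoly phi p)^`M(i) = map_mpoly phi p^`M(i).
Proof.
by apply/mpolyP => m; rewrite mcoeff_mderiv !mcoeff_map_mpoly mcoeff_mderiv
  raddfMn.
Qed.

End MapMPoly.

(** * Homogenization, the affine chart and the hyperplane at infinity *)

Section Homogenize.
Context {R : comNzRingType} {n : nat}.
Implicit Types (p : {mpoly R[n]}) (q : {mpoly R[n.+1]}) (u : 'rV[R]_n).

(** The point [(a, u)]: [a = 1] gives the affine chart, [a = 0] the hyperplane at infinity. *)
Definition pcons (a : R) u : 'rV[R]_n.+1 :=
  \row_j oapp (u ord0) a (unlift ord0 j).

Lemma pcons0 a u : pcons a u ord0 ord0 = a.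
Proof. by rewrite mxE unlift_none. Qed.

Lemma pconsS a u i : pcons a u ord0 (lift ord0 i) = u ord0 i.
Proof. by rewrite mxE liftK. Qed.

Lemma pcons_neq0 u : pcons 1 u != 0.
Proof.
by apply/negP => /eqP /rowP /(_ ord0) /eqP; rewrite pcons0 mxE oner_eq0.
Qed.

(** The substitution x_0 := 1, written through [mmap] so that it is a ring morphism. *)
Definition dehomogenize : {mpoly R[n.+1]} -> {mpoly R[n]} :=
  mmap (@mpolyC n R) (fun j => oapp (fun i => 'X_i) 1 (unlift ord0 j)).

HB.instance Definition _ := GRing.RMorphism.copy dehomogenize
  (mmap (@mpolyC n R) (fun j => oapp (fun i => 'X_i) 1 (unlift ord0 j))).

Lemma dehomogenizeC c : dehomogenize c%:MP = c%:MP.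
Proof. exact: mmapC. Qed.

Lemma dehomogenizeX j :
  dehomogenize 'X_j = oapp (fun i => 'X_i) 1 (unlift ord0 j).
Proof. by rewrite [LHS]mmapX mmap1U. Qed.

Lemma dehomogenizeK p : dehomogenize (homogenize p) = p.
Proof.
rewrite /homogenize raddf_sum [RHS](mpolyE p) /=.
apply: eq_bigr => m _; rewrite -!mul_mpolyC rmorphM /= dehomogenizeC.
congr (_ * _); rewrite rmorphM rmorphXn rmorph_prod /= dehomogenizeX.
rewrite unlift_none expr1n mul1r mpolyXE_id; apply: eq_bigr => i _.
by rewrite rmorphXn /= dehomogenizeX liftK.
Qed.

Lemma meval_dehomogenize q u :
  (dehomogenize q).@[u ord0] = q.@[pcons 1 u ord0].
Proof.
move: q; apply: mpoly_alg_ind => [c|j|p q IHp IHq|p q IHp IHq].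
- by rewrite dehomogenizeC !mevalC.
- rewrite dehomogenizeX mevalXU mxE; case: unliftP => [i|] _ /=.
    by rewrite mevalXU.
  by rewrite meval1.
- by rewrite !rmorphD /= IHp IHq.
- by rewrite !rmorphM /= IHp IHq.
Qed.

Lemma mderiv_dehomogenize q i :
  (dehomogenize q)^`M(i) = dehomogenize q^`M(lift ord0 i).
Proof.
move: q; apply: mpoly_alg_ind => [c|j|p q IHp IHq|p q IHp IHq].
- by rewrite dehomogenizeC !mderivC rmorph0.
- rewrite dehomogenizeX mderivXU rmorph_nat.
  case: unliftP => [k|] -> /=.
    by rewrite mderivXU (inj_eq lift_inj).
  by rewrite -mpolyC1 mderivC.
- by rewrite rmorphD !mderivD rmorphD /= IHp IHq.
- by rewrite rmorphM !mderivM rmorphD !rmorphM /= IHp IHq.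
Qed.

Lemma meval_homogenize1 p u : (homogenize p).@[pcons 1 u ord0] = p.@[u ord0].
Proof. by rewrite -meval_dehomogenize dehomogenizeK. Qed.

Lemma mderiv_homogenize1 p u i :
  ((homogenize p)^`M(lift ord0 i)).@[pcons 1 u ord0] = (p^`M(i)).@[u ord0].
Proof. by rewrite -meval_dehomogenize -mderiv_dehomogenize dehomogenizeK. Qed.

Lemma homogenize_dhomog p : homogenize p \is (tdeg p).-homog for mdeg.
Proof.
rewrite /homogenize big_seq; apply: rpred_sum => m m_in; apply: dhomogZ.
have le_m : (mdeg m <= tdeg p)%N.
  by rewrite -ltnS; apply: leq_trans (msize_mdeg_lt m_in) (leqSpred _).
have Xhom i k : 'X_i ^+ k \is [in R[n.+1], k.-homog].
  by rewrite mpolyXn dhomogX /= mdegMn mdeg1 mul1n.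
rewrite -[X in X.-homog](subnK le_m); apply: dhomogM => //.
by rewrite mdegE; elim/big_rec2: _ => [|i d q _];
  [exact: dhomog1|exact: dhomogM].
Qed.

(** A monomial [m] carries the factor x_0 to the power [tdeg p - mdeg m], which at x_0 = 0 is 1 for
    top degree monomials and 0 for the others. *)
Lemma meval_homogenize0 p (w : 'rV[R]_n.+1) : w ord0 ord0 = 0 ->
  (homogenize p).@[w ord0] = (topform p).@[fun i => w ord0 (lift ord0 i)].
Proof.
move=> w0; rewrite /homogenize /topform pihomogE !raddf_sum /=.
rewrite [RHS]big_mkcond /= !big_seq; apply: eq_bigr => m m_in.
have le_m : (mdeg m <= tdeg p)%N.
  by rewrite -ltnS; apply: leq_trans (msize_mdeg_lt m_in) (leqSpred _).
rewrite mevalZ mevalM rmorphXn /= mevalXU w0 expr0n subn_eq0.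
rewrite eqn_leq le_m /=; case: ifP => _; last by rewrite mul0r mulr0.
rewrite mul1r mevalZ mevalX rmorph_prod /=; congr (_ * _).
by apply: eq_bigr => i _; rewrite rmorphXn /= mevalXU.
Qed.

End Homogenize.

Section MapHomogenize.
Context {F K : comNzRingType} (phi : {rmorphism F -> K}).

(** Injectivity preserves the support, hence the degree on which homogenization depends. *)
Lemma map_mpoly_homogenize n (p : {mpoly F[n]}) : injective phi ->
  map_mpoly phi (homogenize p) = homogenize (map_mpoly phi p).
Proof.
move=> phi_inj; have supp := msupp_map_mpoly p phi_inj.
have degE : tdeg (map_mpoly phi p) = tdeg p.
  by rewrite /tdeg !mmeasureE (perm_big _ supp).
rewrite /homogenize degE (perm_big _ supp) raddf_sum /=.
apply: eq_bigr => m _; rewrite map_mpolyZ mcoeff_map_mpoly; congr (_ *: _).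
rewrite rmorphM rmorphXn rmorph_prod /= map_mpolyX; congr (_ * _).
by apply: eq_bigr => i _; rewrite rmorphXn /= map_mpolyX.
Qed.

End MapHomogenize.

(** * Subsets of prescribed size, and full column rank as linear independence *)

Lemma subset_of_card (T : finType) (A : {pred T}) (k : nat) :
  (k <= #|A|)%N -> exists2 B : {set T}, #|B| = k & B \subset A.
Proof.
move=> /card_geqP[s [s_uniq s_size sA]]; exists [set x in s].
  by rewrite cardsE (card_uniqP s_uniq).
by apply/fintype.subsetP => x; rewrite inE; exact: sA.
Qed.

(** The coefficients are indexed by [nat] rather than by ordinals, so that the length of a list of
    polynomials can be rewritten without casts. *)
Lemma column_rankP (K : fieldType) (m t : nat) (A : 'M[K]_(m, t)) :
  \rank A = t <->
  forall c : nat -> K, (forall i, \sum_(j < t) c j * A i j = 0) ->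
    forall j, (j < t)%N -> c j = 0.
Proof.
rewrite -mxrank_tr; split.
  move=> /eqP fr c c0 j jlt.
  have /eqP : (\row_(j < t) c j) *m A^T = 0.
    apply/rowP => i; rewrite !mxE -[RHS](c0 i).
    by apply: eq_bigr => k _; rewrite !mxE.
  rewrite mulmx_free_eq0 // => /eqP /rowP /(_ (Ordinal jlt)).
  by rewrite !mxE.
move=> indep; apply/eqP/inj_row_free => v v0.
pose c (j : nat) : K := oapp (v ord0) 0 (insub j).
have cE (j : 'I_t) : c j = v ord0 j by rewrite /c valK.
apply/rowP => j; rewrite mxE -cE; apply: indep => // i.
transitivity ((v *m A^T) ord0 i); last by rewrite v0 mxE.
by rewrite mxE; apply: eq_bigr => k _; rewrite cE !mxE.
Qed.

(** * Complex zeros, resultants and discriminants *)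

Section ComplexZeros.
Context {R : realType} {n : nat}.
Implicit Types (fs : seq {mpoly R[n]}) (x : 'rV[R]_n) (u : 'rV[R[i]]_n).

Lemma meval_complexify (p : {mpoly R[n]}) x :
  (complexify p).@[map_mx (real_complex R) x ord0] = (p.@[x ord0])%:C%C.
Proof.
rewrite -meval_map_mpoly; apply: meval_eq => i.
by rewrite mxE.
Qed.

Lemma common_zero_real fs x : (forall p, p \in fs -> p.@[x ord0] = 0) ->
  common_zero fs (map_mx (real_complex R) x).
Proof. by move=> fs0 p /fs0 p0; rewrite meval_complexify p0. Qed.

Lemma complexify_homogenize (p : {mpoly R[n]}) :
  complexify (homogenize p) = homogenize (complexify p).
Proof. by apply: map_mpoly_homogenize => x y []. Qed.

Lemma common_zero_homogenize fs u : common_zero fs u ->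
  common_zero [seq homogenize p | p <- fs] (pcons 1 u).
Proof.
move=> fs0 _ /mapP[p p_fs ->].
by rewrite complexify_homogenize meval_homogenize1 fs0.
Qed.

Lemma hRes_no_zero fs x : hRes_neq0 fs ->
  ~ (forall p, p \in fs -> p.@[x ord0] = 0).
Proof.
move=> res /common_zero_real /common_zero_homogenize fs0; apply: res.
by exists (pcons 1 (map_mx (real_complex R) x)); split => //; exact: pcons_neq0.
Qed.

Lemma full_column_rankP fs u :
  full_column_rank fs u <->
  forall c : nat -> R[i],
    (forall i, \sum_(0 <= j < size fs)
       c j * ((complexify fs`_j)^`M(i)).@[u ord0] = 0) ->
    forall j, (j < size fs)%N -> c j = 0.
Proof.
have gradE (c : nat -> R[i]) i :
    \sum_(0 <= j < size fs) c j * ((complexify fs`_j)^`M(i)).@[u ord0] =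
    \sum_(j < size fs) c j * gradmx fs u i j.
  by rewrite big_mkord; apply: eq_bigr => j _; rewrite mxE.
apply: (iff_trans (column_rankP _)); split=> indep c c0; apply: indep => i.
  by rewrite -gradE.
by rewrite gradE.
Qed.

(** This merges the three cases of [Disc_neq0]. For a single form, a nontrivial relation between the
    columns means that the gradient vanishes. *)
Lemma Disc_full_column_rank fs u : Disc_neq0 fs -> u != 0 ->
  common_zero fs u -> full_column_rank fs u.
Proof.
case: fs => [|f [|g fs]] disc u0 fsu0.
- exact/full_column_rankP.
- apply/full_column_rankP => c c0 [|//] _; apply/eqP/negP => /negP c_neq0.
  apply: disc; exists u; split=> // i.
  by have /eqP := c0 i; rewrite big_nat1 mulf_eq0 (negbTE c_neq0) => /eqP.
- by apply: contrapT => nfull; apply: disc; exists u.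
Qed.

End ComplexZeros.

(** * Jacobian ranks of a system and of its homogenization *)

Section Dehomogenization.
Context {R : realType} {n : nat}.
Implicit Types (fs : seq {mpoly R[n]}) (u : 'rV[R[i]]_n).

(* Euler's identity writes the derivative in the homogenizing variable in terms
   of the others at a zero, so the extra row of the Jacobian is redundant. *)
Lemma full_column_rank_dehomogenize fs u : common_zero fs u ->
  full_column_rank [seq homogenize p | p <- fs] (pcons 1 u) ->
  full_column_rank fs u.
Proof.
move=> fsu0 /full_column_rankP full; apply/full_column_rankP => c c0 j jlt.
rewrite size_map in full; apply: full jlt => i.
have dE j' : (j' < size fs)%N -> forall k,
    ((complexify [seq homogenize p | p <- fs]`_j')^`M(lift ord0 k)).@[pcons 1 u
      ord0]
    = ((complexify fs`_j')^`M(k)).@[u ord0].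
  move=> j'lt k; rewrite (nth_map 0) // complexify_homogenize.
  exact: mderiv_homogenize1.
case: (unliftP ord0 i) => [k ->|->].
  rewrite -[RHS](c0 k) !big_nat; apply: eq_bigr => j' /andP[_ j'lt].
  by rewrite dE.
have d0 j' : (j' < size fs)%N ->
    ((complexify [seq homogenize p | p <- fs]`_j')^`M(ord0)).@[pcons 1 u ord0]
    = - \sum_(k < n) u ord0 k * ((complexify fs`_j')^`M(k)).@[u ord0].
  move=> j'lt; apply/eqP; rewrite -addr_eq0; apply/eqP.
  have := euler_mderiv (pcons 1 u ord0) (homogenize_dhomog (complexify fs`_j')).
  rewrite meval_homogenize1 fsu0 ?mem_nth // mulr0 big_ord_recl pcons0 mul1r.
  rewrite (nth_map 0) // complexify_homogenize => euler; rewrite -[RHS]euler.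
  by congr (_ + _); apply: eq_bigr => k _; rewrite pconsS mderiv_homogenize1.
transitivity (- \sum_(k < n) u ord0 k * \sum_(0 <= j' < size fs)
    c j' * ((complexify fs`_j')^`M(k)).@[u ord0]).
  under [in RHS]eq_bigr => l _ do rewrite mulr_sumr.
  rewrite exchange_big /= -sumrN [LHS]big_nat [RHS]big_nat;
    apply: eq_bigr => j' /andP[_ j'lt].
  rewrite d0 // mulrN mulr_sumr; congr (- _); apply: eq_bigr => k _.
  exact: mulrCA.
by rewrite big1 ?oppr0 // => k _; rewrite c0 mulr0.
Qed.

Lemma hDisc_nonsingular fs : hDisc_neq0 fs -> nonsingular_variety fs.
Proof.
move=> disc u fsu0; apply: full_column_rank_dehomogenize => //.
apply: (Disc_full_column_rank disc (pcons_neq0 u)).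
exact: common_zero_homogenize.
Qed.

End Dehomogenization.

(** * Topology of row vectors, continuity and slopes of polynomials *)

Section RowVectorTopology.
Context {R : realType}.

Lemma coord_le_norm n (x : 'rV[R]_n) i : `|x ord0 i| <= `|x|.
Proof.
rewrite [leRHS]/Num.norm /= mx_normrE.
exact: (le_bigmax _ (fun ij : 'I_1 * 'I_n => `|x ij.1 ij.2|) (ord0, i)).
Qed.

Lemma rV_norm_le n (x : 'rV[R]_n) r : 0 <= r ->
  (forall i, `|x ord0 i| <= r) -> `|x| <= r.
Proof.
move=> r0 xr; rewrite [leLHS]/Num.norm /= mx_normrE.
by apply/bigmax_leP; split=> // -[i j] _ /=; rewrite ord1.
Qed.

Lemma continuous_rV (T : topologicalType) n (F : T -> 'rV[R]_n) :
  (forall i, continuous (fun x => F x ord0 i)) -> continuous F.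
Proof.
move=> F_cont x; apply/cvgrPdist_le => e e0.
have : \forall y \near x, forall i, `|F x ord0 i - F y ord0 i| <= e.
  apply: filter_forall => i.
  exact: (cvgrPdist_le _ _).1 (F_cont i x) e e0.
apply: filterS => y Fy; apply: rV_norm_le => [|i]; first exact: ltW.
by rewrite !mxE.
Qed.

Lemma continuous_sumr (T : topologicalType) (I : finType) (F : I -> T -> R) :
  (forall i, continuous (F i)) -> continuous (fun x => \sum_i F i x).
Proof.
move=> F_cont x; apply: cvg_big => [|i _]; last exact: F_cont.
by move=> z; exact: add_continuous.
Qed.

Lemma continuous_addr (T : topologicalType) (F G : T -> R) :
  continuous F -> continuous G -> continuous (fun x => F x + G x).
Proof. by move=> Fc Gc x; apply: cvgD; [exact: Fc | exact: Gc]. Qed.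

Lemma continuous_mulr (T : topologicalType) (F G : T -> R) :
  continuous F -> continuous G -> continuous (fun x => F x * G x).
Proof. by move=> Fc Gc x; apply: cvgM; [exact: Fc | exact: Gc]. Qed.

Lemma continuous_meval n (p : {mpoly R[n]}) :
  continuous (fun x : 'rV[R]_n => p.@[x ord0]).
Proof.
move: p; apply: mpoly_alg_ind => [c|i|p q IHp IHq|p q IHp IHq].
- under eq_fun do rewrite mevalC; exact: cst_continuous.
- under eq_fun do rewrite mevalXU; exact: coord_continuous.
- under eq_fun do rewrite mevalD; exact: continuous_addr.
- under eq_fun do rewrite mevalM; exact: continuous_mulr.
Qed.

(** Hadamard's factorization of a difference of values, built by polynomial induction. Joint
    continuity of the slopes [Q] replaces mean value estimates. *)
Lemma meval_slope n (p : {mpoly R[n]}) :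
  exists Q : 'I_n -> 'rV[R]_n * 'rV[R]_n -> R,
    [/\ forall i, continuous (Q i),
        forall i (v : 'rV[R]_n), Q i (v, v) = (p^`M(i)).@[v ord0] &
        forall x y : 'rV[R]_n, p.@[x ord0] - p.@[y ord0] =
          \sum_i (x - y) ord0 i * Q i (x, y)].
Proof.
move: p; apply: mpoly_alg_ind => [c|j|p q|p q].
- exists (fun _ _ => 0); split=> [i|i v|x y]; first exact: cst_continuous.
    by rewrite mderivC meval0.
  by rewrite !mevalC subrr big1 // => i _; rewrite mulr0.
- exists (fun i _ => (i == j)%:R); split=> [i|i v|x y].
  + exact: cst_continuous.
  + by rewrite mderivXU; case: (i == j); rewrite ?meval1 ?meval0.
  + rewrite !mevalXU (bigD1 j) //= eqxx mulr1 !mxE big1 ?addr0 // => i.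
    by move=> /negbTE ->; rewrite mulr0.
- move=> [Qp [Qpc Qpd Qps]] [Qq [Qqc Qqd Qqs]].
  exists (fun i z => Qp i z + Qq i z); split=> [i|i v|x y].
  + exact: continuous_addr.
  + by rewrite mderivD mevalD Qpd Qqd.
  + rewrite !mevalD opprD addrACA Qps Qqs -big_split /=.
    by apply: eq_bigr => i _; rewrite mulrDr.
- move=> [Qp [Qpc Qpd Qps]] [Qq [Qqc Qqd Qqs]].
  (* Slopes read off from p(x)q(x) - p(y)q(y) = q(y)(p(x) - p(y)) + p(x)(q(x) - q(y)). *)
  exists (fun i z => Qp i z * q.@[z.2 ord0] + p.@[z.1 ord0] * Qq i z).
  split=> [i|i v|x y].
  + apply: continuous_addr; apply: continuous_mulr => //= z.
      exact: (@continuous_comp _ _ _ snd (fun x : 'rV[R]_n => q.@[x ord0]) z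
                cvg_snd (@continuous_meval _ q _)).
    exact: (@continuous_comp _ _ _ fst (fun x : 'rV[R]_n => p.@[x ord0]) z
              cvg_fst (@continuous_meval _ p _)).
  + by rewrite mderivM mevalD !mevalM Qpd Qqd.
  + transitivity (q.@[y ord0] * (p.@[x ord0] - p.@[y ord0])
                  + p.@[x ord0] * (q.@[x ord0] - q.@[y ord0])).
      by rewrite !mevalM; ring.
    rewrite Qps Qqs !mulr_sumr -big_split /=.
    by apply: eq_bigr => i _; ring.
Qed.

End RowVectorTopology.

(** * Local surjectivity of polynomial maps *)

Section LocalSurjectivity.
Context {R : realType}.

(* A self-map of a closed ball that halves distances: it decreases the
   displacement [`|T y - y|], which attains its minimum by compactness. *)
Lemma half_contraction_fixed_point t (T : 'rV[R]_t -> 'rV[R]_t) (r : R) :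
  0 <= r -> continuous T ->
  (forall y, `|y| <= r -> `|T y| <= r) ->
  (forall y z, `|y| <= r -> `|z| <= r -> `|T y - T z| <= `|y - z| / 2) ->
  exists2 y, `|y| <= r & T y = y.
Proof.
move=> r0 Tc Tr Tcontr; pose K : set 'rV[R]_t := [set y | `|y| <= r].
have K0 : K !=set0 by exists 0; rewrite /K /= normr0.
have Kcpt : compact K.
  apply: bounded_closed_compact.
    by exists r; split; [exact: num_real | move=> s rs y /le_trans; apply;
      exact: ltW].
  have := @preimage_closed 'rV[R]_t R Num.norm [set s | s <= r].
  apply; last exact: closed_le.
  by move=> y _; exact: norm_continuous.
have dc : continuous (fun y => `|T y - y|).
  move=> y; apply: (@continuous_comp _ _ _ (fun y => T y - y) Num.norm).
    exact: (@continuousB _ _ _ T idfun y (Tc y) cvg_id).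
  exact: norm_continuous.
have [y] := EVT_min_rV K0 Kcpt (continuous_subspaceT dc).
rewrite inE => yr ymin; exists y => //; apply/eqP; rewrite -subr_eq0 -normr_le0.
(* Minimality at [y], compared with [T y], gives [|T y - y| <= |T (T y) - T y|], which is at most
   half of [|T y - y|]; so the displacement is 0. *)
have := ymin (T y); rewrite inE => /(_ (Tr _ yr)).
have := Tcontr _ _ (Tr _ yr) yr; lra.
Qed.

(** With [L] a left inverse of the Jacobian, restrict [F] to the points [v + y *m L]. The increment
    [G y] of [F] from [v] then has slope matrix [M] close to the identity, so [y - G y + w] defines
    a contraction whose fixed point solves [G y = w]. *)
Lemma meval_locally_onto n t (F : 'I_t -> {mpoly R[n]}) (v : 'rV[R]_n)
    (U : set 'rV[R]_n) :
  \rank (\matrix_(i < n, j < t) ((F j)^`M(i)).@[v ord0]) = t -> nbhs v U ->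
  \forall w \near (0 : 'rV[R]_t),
    exists2 x, U x & forall j, (F j).@[x ord0] = (F j).@[v ord0] + (w :
      'rV[R]_t) ord0 j.
Proof.
set D := \matrix_(_, _) _ => /eqP /row_fullP[L LD] Uv.
have /choice[Q HQ] := fun j => meval_slope (F j).
have Qc j i : continuous (Q j i) by case: (HQ j).
have Qd j i u : Q j i (u, u) = ((F j)^`M(i)).@[u ord0] by case: (HQ j).
have Qs j (x y : 'rV_n) : (F j).@[x ord0] - (F j).@[y ord0] =
    \sum_i (x - y) ord0 i * Q j i (x, y) by case: (HQ j).
pose M k j (z : 'rV[R]_n * 'rV[R]_n) : R := \sum_i L k i * Q j i z.
have Mc k j : continuous (M k j).
  by apply: continuous_sumr => i; apply: continuous_mulr => //;
    exact: cst_continuous.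
have Mv k j : M k j (v, v) = (k == j)%:R.
  have /matrixP /(_ k j) := LD; rewrite !mxE => <-; apply: eq_bigr => i _.
  by rewrite Qd mxE.
(* A sum of [t] errors of size [e] is at most 1/2; [t.+1] keeps the denominator nonzero for
   [t = 0]. *)
pose e : R := (2 * t.+1%:R)^-1.
have e0 : 0 < e by rewrite invr_gt0 mulr_gt0.
have : \forall z \near ((v, v) : 'rV[R]_n * 'rV[R]_n), forall kj : 'I_t * 'I_t,
    `|(kj.1 == kj.2)%:R - M kj.1 kj.2 z| <= e.
  apply: (@filter_forall _ _ _ _ (nbhs_filter (v, v))) => -[k j] /=.
  rewrite -Mv.
  exact: (cvgrPdist_le _ _).1 (Mc k j (v, v)) e e0.
(* A product neighbourhood of [(v, v)], so that the two arguments of the slopes can vary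
   separately. *)
case=> -[/= V1 V2] [V1v V2v] MV.
pose X (y : 'rV[R]_t) := v + y *m L.
have Xc : continuous X.
  apply: continuous_rV => i y.
  under eq_fun do rewrite !mxE.
  move: y; apply: continuous_addr; first exact: cst_continuous.
  apply: continuous_sumr => k; apply: continuous_mulr;
    first exact: coord_continuous.
  exact: cst_continuous.
have X0 : X 0 = v by rewrite /X mul0mx addr0.
have : \forall y \near (0 : 'rV[R]_t), [/\ V1 (X y), V2 (X y) & U (X y)].
  apply: (Xc 0 [set x | [/\ V1 x, V2 x & U x]]); rewrite X0.
  by near=> x; split; near: x.
move=> /nbhs_normP[/= r0 r0_gt0 Xr0].
pose r := r0 / 2.
have r_gt0 : 0 < r by rewrite divr_gt0.
have {}Xr0 y : `|y| <= r -> [/\ V1 (X y), V2 (X y) & U (X y)].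
  move=> yr; apply: Xr0; rewrite /ball_ /= sub0r normrN.
  by rewrite (le_lt_trans yr) // ltr_pdivrMr // ltr_pMr // ltr1n.
near=> w.
(* Since [T 0 = w] and [T] halves distances, this bound keeps [T] inside the ball of radius [r]. *)
have wr : `|w| <= r / 2.
  near: w; apply: filterS (nbhs0_le (V := 'rV[R]_t) (divr_gt0 r_gt0 (ltr0Sn _
    1))) => //.
pose G y : 'rV[R]_t := \row_j ((F j).@[X y ord0] - (F j).@[v ord0]).
pose T y := y - G y + w.
have Tcontr y z : `|y| <= r -> `|z| <= r -> `|T y - T z| <= `|y - z| / 2.
  move=> /Xr0[V1y _ _] /Xr0[_ V2z _]; apply: rV_norm_le => [|j].
    by rewrite divr_ge0.
  (* The displacement [X y - X z] is [(y - z) *m L], so [T y - T z] is [y - z] times the identity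
     minus [M], whose entries are at most [e]. *)
  have -> : (T y - T z) ord0 j =
      \sum_k (y - z) ord0 k * ((k == j)%:R - M k j (X y, X z)).
    under eq_bigr do rewrite mulrBr.
    rewrite sumrB (bigD1 j) //= eqxx mulr1 big1 ?addr0; last first.
      by move=> k /negbTE ->; rewrite mulr0.
    have -> : \sum_k (y - z) ord0 k * M k j (X y, X z) =
        (F j).@[X y ord0] - (F j).@[X z ord0].
      rewrite Qs /X opprD addrACA subrr add0r -mulmxBl.
      under eq_bigr do rewrite mulr_sumr.
      rewrite exchange_big /=; apply: eq_bigr => i _.
      by rewrite mxE mulr_suml; apply: eq_bigr => k _; rewrite mulrA.
    by rewrite !mxE; ring.
  apply: le_trans (ler_norm_sum _ _ _) _.
  apply: (@le_trans _ _ (\sum_(k < t) `|y - z| * e)).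
    apply: ler_sum => k _; rewrite normrM ler_pM ?coord_le_norm //.
    exact: (MV (X y, X z) _ (k, j)).
  rewrite sumr_const card_ord -[leLHS]mulr_natr -mulrA ler_wpM2l //.
  rewrite /e invfM -mulrA ler_piMr ?invr_ge0 // mulrC.
  by rewrite ler_pdivrMr // mul1r ler_nat.
have TG0 : T 0 = w.
  by apply/rowP => j; rewrite !mxE X0; ring.
have Tr y : `|y| <= r -> `|T y| <= r.
  move=> yr; have := Tcontr y 0 yr;
    rewrite normr0 subr0 TG0 => /(_ (ltW r_gt0)).
  move=> Tyw; have := ler_normD (T y - w) w; rewrite subrK; lra.
have Tc : continuous T.
  apply: continuous_rV => j.
  have TE y : T y ord0 j = y ord0 j + (- (F j).@[X y ord0] + ((F j).@[v ord0] +
    w ord0 j)).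
    by rewrite !mxE; ring.
  under eq_fun do rewrite TE.
  apply: continuous_addr; first exact: coord_continuous.
  apply: continuous_addr; last exact: cst_continuous.
  move=> y; apply: continuousN.
  exact: (@continuous_comp _ _ _ X (fun x : 'rV[R]_n => (F j).@[x ord0]) y
            (Xc y) (@continuous_meval _ _ _ _)).
have [y yr Ty] := half_contraction_fixed_point (ltW r_gt0) Tc Tr Tcontr.
exists (X y) => [|j]; first by have [] := Xr0 _ yr.
have /rowP /(_ j) := Ty; rewrite !mxE => Tyj; lra.
Unshelve. all: by end_near. Qed.

End LocalSurjectivity.

(** * Descent directions and the number of active constraints *)

Lemma exists_descent (R : realType) (n : nat) (f : {mpoly R[n]})
    (fs : seq {mpoly R[n]}) (v : 'rV[R]_n) (U : set 'rV[R]_n) :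
  full_column_rank (f :: fs) (map_mx (real_complex R) v) ->
  (forall p, p \in f :: fs -> p.@[v ord0] = 0) -> nbhs v U ->
  exists2 x, U x & f.@[x ord0] < 0 /\ (forall p, p \in fs -> p.@[x ord0] = 0).
Proof.
move=> full fs0 Uv; pose F (j : 'I_(size (f :: fs))) := (f :: fs)`_j.
have rkF : \rank (\matrix_(i < n, j < size (f :: fs))
    ((F j)^`M(i)).@[v ord0]) = size (f :: fs).
  (* The rank hypothesis is over the complex numbers; rank is unchanged by field extension. *)
  rewrite -(mxrank_map (real_complex R)) -[RHS]full; congr (\rank _).
  by apply/matrixP => i j; rewrite !mxE /complexify mderiv_map_mpoly
    meval_complexify.
have /nbhs_normP[r /= r0 Hr] := meval_locally_onto rkF Uv.
(* The prescribed change of values: [f] drops to [- (r / 2)] and the rest of the list stays at 0. *)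
pose w : 'rV[R]_(size (f :: fs)) := \row_j (if val j == 0 then - (r / 2) else
  0).
have [|x Ux xw] := Hr w.
  rewrite /ball_ /= sub0r normrN; apply: (@le_lt_trans _ _ (r / 2)); last lra.
  apply: rV_norm_le => [|j]; first lra.
  by rewrite mxE; case: ifP => _; rewrite ?normrN ?normr0 ?ger0_norm //; lra.
have Fx j : (F j).@[x ord0] = w ord0 j by rewrite xw fs0 ?add0r // mem_nth.
exists x => //; split=> [|p /(nthP 0)[j jlt <-]].
  by have := Fx ord0; rewrite !mxE /= => ->; lra.
have jlt' : (j.+1 < size (f :: fs))%N by [].
by have := Fx (Ordinal jlt'); rewrite !mxE.
Qed.

(** Otherwise [n] of the forms vanish together at the nonzero point [v], against a resultant
    condition. *)
Lemma few_active (R : realType) (n m1 m2 : nat) (h : 'I_m1 -> {mpoly R[n]})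
    (g : 'I_m2 -> {mpoly R[n]}) (v : 'rV[R]_n) :
  (forall (I : {set 'I_m1}) (J : {set 'I_m2}), (#|I| + #|J| = n)%N ->
     Res_neq0 ([seq h i | i in I] ++ [seq g j | j in J])) ->
  v != 0 -> (forall i, (h i).@[v ord0] = 0) ->
  (m1 + #|[set j | ((g j).@[v ord0] == 0)%R]%SET| < n)%N.
Proof.
move=> res v0 hv; rewrite ltnNge; apply/negP => many.
(* The sizes [minn m1 n] and the truncated [n - m1] add up to [n] even when [m1] exceeds [n]. *)
have [I cardI _] : exists2 I : {set 'I_m1}, #|I| = minn m1 n & I \subset 'I_m1.
  by apply: subset_of_card; rewrite card_ord geq_minl.
have [J cardJ /fintype.subsetP JA] : exists2 J : {set 'I_m2}, #|J| = (n - m1)%N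
  &
    J \subset [set j | ((g j).@[v ord0] == 0)%R]%SET.
  by apply: subset_of_card; rewrite leq_subLR.
apply: (res I J); first by rewrite cardI cardJ minnC minnE subnK ?leq_subr.
exists (map_mx (real_complex R) v); split.
  by rewrite map_mx_eq0.
apply: common_zero_real => p; rewrite mem_cat => /orP[] /fintype.imageP[k kin
  ->] //.
by have := JA _ kin; rewrite inE => /eqP.
Qed.

(** * The infimum as a real number *)

Section Minimum.
Context {R : realType} {n : nat}.
Implicit Types (f : {mpoly R[n]}) (S : set 'rV[R]_n).

Lemma attains_min_of_le f S v : S v ->
  (forall x, S x -> f.@[v ord0] <= f.@[x ord0]) -> attains_min f S.
Proof.
move=> Sv minv; exists v; split=> //; apply/eqP; rewrite eq_le; apply/andP;
  split.
  by apply: le_ereal_inf_tmp => _ [x Sx <-]; rewrite lee_fin minv.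
by apply: ereal_inf_lbound; exists v.
Qed.

(** A point of [S] excludes the value +oo, so the extended infimum is a real greatest lower
    bound. *)
Lemma fmin_greatest f S : S !=set0 -> (-oo < fmin f S)%E ->
  exists m, (forall x, S x -> m <= f.@[x ord0]) /\
    (forall m', (forall x, S x -> m' <= f.@[x ord0]) -> m' <= m).
Proof.
move=> [s Ss] fminNy.
have lb x : S x -> (fmin f S <= (f.@[x ord0])%:E)%E.
  by move=> Sx; apply: ereal_inf_lbound; exists x.
have fmin_fin : fmin f S \is a fin_num.
  by rewrite fin_numE gt_eqF //= lt_eqF // (le_lt_trans (lb _ Ss)) ?ltry.
exists (fine (fmin f S)); split=> [x Sx|m' m'lb].
  by rewrite -lee_fin fineK // lb.
rewrite -lee_fin fineK //; apply: le_ereal_inf_tmp => _ [x Sx <-].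
by rewrite lee_fin m'lb.
Qed.

Lemma tdeg0_meval f x y : tdeg f = 0 -> f.@[x] = f.@[y] :> R.
Proof.
move=> d0; have : (msize f <= 1)%N by move: d0; rewrite /tdeg;
  case: (msize f) => [|[|]].
by move=> /msize1_polyC ->; rewrite !mevalC.
Qed.

End Minimum.

(** * Minimization over the projective cone, for claim (d) *)

Section ProjectiveMinimum.
Context {R : realType} {n m1 m2 : nat}.
Context (f : {mpoly R[n]}) (h : 'I_m1 -> {mpoly R[n]})
  (g : 'I_m2 -> {mpoly R[n]}).
Local Notation S := (semialg h g).
Local Notation W := (Sprj h g `&` [set w : 'rV[R]_n.+1 | 0 <= w ord0 ord0]).

Definition dehom_pt (w : 'rV[R]_n.+1) : 'rV[R]_n :=
  \row_i (w ord0 (lift ord0 i) / w ord0 ord0).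

Lemma meval_homogenize_pt (p : {mpoly R[n]}) (w : 'rV[R]_n.+1) :
  w ord0 ord0 != 0 ->
  (homogenize p).@[w ord0] = w ord0 ord0 ^+ tdeg p * p.@[dehom_pt w ord0].
Proof.
move=> w0; rewrite homogenizeE //; congr (_ * _); apply: meval_eq => i.
by rewrite mxE.
Qed.

Lemma Sprj_dehom_pt (w : 'rV[R]_n.+1) : 0 < w ord0 ord0 -> Sprj h g w <-> S
  (dehom_pt w).
Proof.
move=> w0; have wn0 : w ord0 ord0 != 0 by rewrite gt_eqF.
split=> -[hw gw]; split=> [i|j].
- have /eqP := hw i; rewrite meval_homogenize_pt // mulf_eq0 expf_eq0.
  by rewrite (negbTE wn0) andbF => /eqP.
- by have := gw j; rewrite meval_homogenize_pt // pmulr_rge0 ?exprn_gt0.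
- by rewrite meval_homogenize_pt // hw mulr0.
- by rewrite meval_homogenize_pt // mulr_ge0 // exprn_ge0 // ltW.
Qed.

Lemma dehom_ptK (c : R) (x : 'rV[R]_n) : c != 0 -> dehom_pt (c *: pcons 1 x) =
  x.
Proof.
move=> c0; apply/rowP => i; rewrite mxE [X in X / _]mxE [X in _ / X]mxE pcons0
  pconsS mulr1.
by rewrite mulrC mulKf.
Qed.

(* The minimum over the unit sphere of [f~ - m x_0^d], with [m] the infimum of
   [f] on [S], is zero since it bounds [f - m] from below on [S]. *)
Lemma projective_min :
  closed_at_infty h g -> S !=set0 -> (-oo < fmin f S)%E -> tdeg f != 0 ->
  ~ attains_min f S ->
  exists w : 'rV[R]_n.+1, [/\ w != 0, w ord0 ord0 = 0, Sprj h g w,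
    (homogenize f).@[w ord0] = 0 &
    forall w' : 'rV[R]_n.+1, Sprj h g w' -> w' ord0 ord0 = 0 -> 0 <=
      (homogenize f).@[w' ord0]].
Proof.
move=> clos [s Ss] fNy d0 nattain.
have [m [m_lb m_max]] := fmin_greatest (ex_intro _ s Ss) fNy.
pose phi (w : 'rV[R]_n.+1) := (homogenize f).@[w ord0] - m * w ord0 ord0 ^+
  tdeg f.
have phiE (w : 'rV[R]_n.+1) : w ord0 ord0 != 0 ->
    phi w = w ord0 ord0 ^+ tdeg f * (f.@[dehom_pt w ord0] - m).
  by move=> w0; rewrite /phi meval_homogenize_pt // mulrBr [m * _]mulrC.
have phi_inf (w : 'rV[R]_n.+1) : w ord0 ord0 = 0 -> phi w = (homogenize f).@[w
  ord0].
  by move=> w0; rewrite /phi w0 expr0n (negbTE d0) mulr0 subr0.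
have phi_cont : continuous phi.
  have -> : phi = fun w : 'rV[R]_n.+1 => (homogenize f - m%:MP * 'X_ord0 ^+
    tdeg f).@[w ord0].
    apply/funext => w.
    by rewrite mevalB mevalM mevalC rmorphXn /= mevalXU.
  exact: continuous_meval.
(* Nonnegativity holds where x_0 > 0 because [m] bounds [f] from below on [S]; closedness at
   infinity and continuity extend it to x_0 = 0. *)
have phi_ge0 (w : 'rV[R]_n.+1) : W w -> 0 <= phi w.
  have sub : Sprj h g `&` [set w : 'rV[R]_n.+1 | 0 < w ord0 ord0] `<=` [set w :
    'rV[R]_n.+1 | 0 <= phi w].
    move=> u [Su /= u0] /=; rewrite phiE ?gt_eqF //.
    apply: mulr_ge0; first by rewrite exprn_ge0 // ltW.
    by rewrite subr_ge0 m_lb //; apply/Sprj_dehom_pt.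
  have phi_closed : closed [set w : 'rV[R]_n.+1 | 0 <= phi w].
    have := @preimage_closed _ _ phi [set s | 0 <= s].
    by apply; [move=> u _; exact: phi_cont | exact: closed_ge].
  rewrite clos => /(closure_subset sub).
  by rewrite -(closure_id _).1.
pose K := W `&` [set w : 'rV[R]_n.+1 | `|w| = 1].
have Kcpt : compact K.
  apply: bounded_closed_compact.
    exists 1; split; first exact: num_real.
    by move=> r r1 w [_ /= ->]; exact: ltW.
  apply: closedI; first by rewrite clos; exact: closed_closure.
  have := @preimage_closed 'rV[R]_n.+1 R Num.norm [set s | s = 1].
  by apply; [move=> u _; exact: norm_continuous | exact: closed_eq].
have norm_pcons x : 1 <= `|pcons 1 x : 'rV[R]_n.+1|.
  have := coord_le_norm (pcons 1 x) ord0; rewrite pcons0 normr1; exact.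
pose c (x : 'rV[R]_n) : R := `|pcons 1 x|^-1.
have c_gt0 x : 0 < c x by rewrite invr_gt0 (lt_le_trans ltr01).
have sphere x : S x -> K (c x *: pcons 1 x).
  move=> Sx; have cx0 : (c x *: pcons 1 x : 'rV[R]_n.+1) ord0 ord0 = c x.
    by rewrite mxE pcons0 mulr1.
  split; last first.
    rewrite /= normrZ gtr0_norm // mulVf //.
    by rewrite gt_eqF // (lt_le_trans ltr01).
  split; last by rewrite /= cx0 ltW.
  by apply/Sprj_dehom_pt; rewrite ?cx0 // dehom_ptK // gt_eqF.
have [w] := EVT_min_rV (ex_intro _ _ (sphere s Ss)) Kcpt (continuous_subspaceT
  phi_cont).
rewrite inE => -[Ww /= w1] wmin.
(* For [x] in [S], scaling (1, x) onto the sphere by [c x <= 1] gives [phi w <= c x ^+ tdeg f * (f x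
   - m) <= f x - m]. So [m + phi w] is again a lower bound, and [m] is the greatest. *)
have phiw0 : phi w = 0.
  apply/eqP; rewrite eq_le phi_ge0 // andbT -(lerD2l m) addr0.
  apply: m_max => x Sx; rewrite -lerBrDl.
  apply: le_trans (wmin _ (mem_set (sphere x Sx))) _.
  have cx0 : (c x *: pcons 1 x : 'rV[R]_n.+1) ord0 ord0 = c x.
    by rewrite mxE pcons0 mulr1.
  rewrite phiE cx0 ?gt_eqF // dehom_ptK ?gt_eqF // ler_piMl ?subr_ge0 ?m_lb //.
  apply: exprn_ile1; first exact: ltW.
  by rewrite invf_le1 // (lt_le_trans ltr01).
have w_inf : w ord0 ord0 = 0.
  apply/eqP; case: (Ww) => Sw /=; rewrite le_eqVlt eq_sym => /orP[//|w0].
  have wn0 : w ord0 ord0 != 0 by rewrite gt_eqF.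
  have fw : f.@[dehom_pt w ord0] = m.
    apply/eqP; rewrite -subr_eq0; move/eqP: phiw0.
    by rewrite phiE // mulf_eq0 expf_eq0 (negbTE wn0) andbF.
  case: nattain; apply: (@attains_min_of_le _ _ _ _ (dehom_pt w)).
    exact/Sprj_dehom_pt.
  by move=> x Sx; rewrite fw m_lb.
exists w; split=> //.
- by rewrite -normr_gt0 w1.
- by case: Ww.
- by rewrite -phi_inf.
- move=> w' Sw' w'0; rewrite -phi_inf // phi_ge0 //; split=> //=.
  by rewrite w'0.
Qed.

Lemma attains_min_closed_at_infty :
  closed_at_infty h g -> S !=set0 -> B (tdeg f) S f ->
  (forall (I : {set 'I_m1}) (J : {set 'I_m2}), (#|I| + #|J| = n)%N ->
     Res_neq0 ([seq topform (h i) | i in I] ++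
               [seq topform (g j) | j in J])) ->
  (forall J : {set 'I_m2}, (m1 + #|J| + 1 <= n)%N ->
     Disc_neq0 (topform f :: [seq topform (h i) | i : 'I_m1] ++
                [seq topform (g j) | j in J])) ->
  attains_min f S.
Proof.
move=> clos S0 [_ fNy] res disc; have [s Ss] := S0.
(* A constant [f] is minimized anywhere; otherwise the term [m] x_0^d vanishes at infinity. *)
have [d0|d0] := eqVneq (tdeg f) 0.
  apply: (attains_min_of_le Ss) => x _.
  by rewrite (tdeg0_meval (s ord0) (x ord0) d0).
apply: contrapT => /(projective_min clos S0 fNy d0).
move=> [w [w_neq0 w0 [hw gw] fw fpos]].
pose v : 'rV[R]_n := \row_i w ord0 (lift ord0 i).
have topE p : (homogenize p).@[w ord0] = (topform p).@[v ord0].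
  by rewrite meval_homogenize0 //; apply: meval_eq => i; rewrite mxE.
have v_neq0 : v != 0.
  apply: contra w_neq0 => /eqP/rowP v0; apply/eqP/rowP => i; rewrite mxE.
  by case: (unliftP ord0 i) => [j|] -> //; have := v0 j; rewrite !mxE.
have hv i : (topform (h i)).@[v ord0] = 0 by rewrite -topE hw.
have := few_active res v_neq0 hv; set A := [set j | _]%SET => active.
have zeros p : p \in topform f :: [seq topform (h i) | i : 'I_m1] ++
    [seq topform (g j) | j in A] -> p.@[v ord0] = 0.
  rewrite inE => /orP[/eqP ->|]; first by rewrite -topE.
  rewrite mem_cat => /orP[] /fintype.imageP[k kA ->] //.
  by move: kA; rewrite inE => /eqP.
have vC_neq0 : map_mx (real_complex R) v != 0 by rewrite map_mx_eq0.
have full := Disc_full_column_rank (disc A _) vC_neq0 (common_zero_real zeros).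
(* Constraints outside [A] are strictly positive at [v], hence on a neighbourhood; only those in [A]
   need to be held at 0 during the descent. *)
have inactive : \forall x \near v, forall j, j \notin A ->
    0 < (topform (g j)).@[(x : 'rV[R]_n) ord0].
  apply: (@filter_forall _ _ _ _ (nbhs_filter v)) => j.
  have [jA|jA] := boolP (j \in A); first by apply: filterE.
  have gv : 0 < (topform (g j)).@[v ord0].
    by move: jA; rewrite inE lt0r -topE gw andbT.
  apply: filterS (cvgr_gt _ (@continuous_meval _ _ (topform (g j)) v) _ gv).
  by move=> x /=.
have [|x xU [fx xz]] := exists_descent (full _) zeros inactive.
  by rewrite addn1.
have infE p : (homogenize p).@[pcons 0 x ord0] = (topform p).@[x ord0].
  rewrite meval_homogenize0 ?pcons0 //; apply: meval_eq => i.
  by rewrite pconsS.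
have Sx : Sprj h g (pcons 0 x).
  split=> [i|j]; rewrite infE.
    by apply: xz; rewrite mem_cat fintype.image_f.
  have [jA|jA] := boolP (j \in A); last by rewrite ltW // xU.
  by rewrite xz // mem_cat fintype.image_f ?orbT.
by have := fpos _ Sx (pcons0 _ _); rewrite infE leNgt fx.
Qed.

End ProjectiveMinimum.

(** * The unconstrained case, for claim (e) *)

Lemma closed_at_infty_unconstrained (R : realType) (n : nat)
    (h g : 'I_0 -> {mpoly R[n]}) : closed_at_infty h g.
Proof.
rewrite /closed_at_infty; have -> : Sprj h g = setT.
  by apply/seteqP; split=> // w _; split=> -[].
rewrite !setTI; apply/seteqP; split=> [w /= w0 U /nbhs_normP[r /= r0 rU]|].
  (* Shifting every coordinate by [r / 2] makes x_0 positive and stays within distance [r] in the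
     maximum norm. *)
  exists (w + const_mx (r / 2)); split; first by rewrite /= !mxE; lra.
  apply: rU; rewrite /ball_ /= opprD addNKr normrN.
  apply: (@le_lt_trans _ _ (r / 2)); last lra.
  by apply: rV_norm_le => [|j]; rewrite ?mxE ?ger0_norm //; lra.
have clo : closed [set w : 'rV[R]_n.+1 | 0 <= w ord0 ord0].
  have := @preimage_closed _ _ (fun w : 'rV[R]_n.+1 => w ord0 ord0) [set s | 0
    <= s].
  by apply; [move=> u _; exact: coord_continuous | exact: closed_ge].
rewrite [X in _ `<=` X](closure_id _).1 //.
by apply: closure_subset => w /= /ltW.
Qed.

Lemma attains_min_unconstrained (R : realType) (n : nat) (f : {mpoly R[n]}) :
  B (tdeg f) [set: 'rV[R]_n] f -> Disc_neq0 [:: topform f] ->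
  attains_min f [set: 'rV[R]_n].
Proof.
pose h (i : 'I_0) : {mpoly R[n]} := 0.
have ST : semialg h h = [set: 'rV[R]_n].
  by apply/seteqP; split=> // x _; split=> -[].
rewrite -ST => Bf disc.
have nil0 (T : eqType) (F : 'I_0 -> T) (J : {pred 'I_0}) : [seq F i | i in J] =
  [::].
  by apply: size0nil; rewrite size_image; apply: eq_card0 => -[].
apply: attains_min_closed_at_infty => //.
- exact: closed_at_infty_unconstrained.
- by rewrite ST; exists 0.
(* Without constraints the resultant condition concerns only [n = 0], where there is no nonzero
   vector. *)
- move=> I J; rewrite !eq_card0 => [n0|[]//|[]//]; rewrite !nil0 /=.
  move=> [u [/eqP u0 _]]; apply: u0; apply/rowP => i.
  by have := ltn_ord i; rewrite -[X in (_ < X)%N]n0.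
- by move=> J _; rewrite !nil0.
Qed.

Theorem theorem2p5 (R : realType) (n m1 m2 : nat) (f : {mpoly R[n]})
    (h : 'I_m1 -> {mpoly R[n]}) (g : 'I_m2 -> {mpoly R[n]}) :
  let S := semialg h g in
  [/\ (* (a) *)
      (n < m1)%N ->
      (exists I : {set 'I_m1},
         #|I| = n.+1 /\ hRes_neq0 [seq h i | i in I]) ->
      S = set0,
      (* (b) *)
      (m1 <= n)%N ->
      (forall J : {set 'I_m2}, #|J| = (n - m1 + 1)%N ->
         hRes_neq0 (codom h ++ [seq g j | j in J])) ->
      forall u, S u ->
        (#|[pred j : 'I_m2 | ((g j).@[u ord0] == 0)%R]| <= n - m1)%N,
      (* (c) *)
      (m1 <= n)%N ->
      (forall J : {set 'I_m2}, (#|J| <= n - m1)%N ->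
         hDisc_neq0 (codom h ++ [seq g j | j in J])) ->
      forall J : {set 'I_m2}, (#|J| <= n - m1)%N ->
        nonsingular_variety (codom h ++ [seq g j | j in J]),
      (* (d); k <= n - m1 - 1 is written m1 + k + 1 <= n, since subtraction on
         nat is truncated *)
      closed_at_infty h g -> S !=set0 -> B (tdeg f) S f ->
      (forall (I : {set 'I_m1}) (J : {set 'I_m2}), (#|I| + #|J| = n)%N ->
         Res_neq0 ([seq topform (h i) | i in I] ++
                   [seq topform (g j) | j in J])) ->
      (forall J : {set 'I_m2}, (m1 + #|J| + 1 <= n)%N ->
         Disc_neq0 (topform f :: [seq topform (h i) | i : 'I_m1] ++
                    [seq topform (g j) | j in J])) ->
      attains_min f S
    & (* (e) *)
      B (tdeg f) [set: 'rV[R]_n] f -> Disc_neq0 [:: topform f] ->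
      attains_min f [set: 'rV[R]_n]].
Proof.
split.
- move=> _ [I [_ res]]; apply/seteqP; split=> // x [hx _].
  by apply: (hRes_no_zero res) => _ /fintype.imageP[i _ ->].
- move=> _ res u [hu _]; rewrite leqNgt; apply/negP => many.
  (* Together with the [m1] equations, these vanishing [g j] form [n + 1] polynomials with a common
     zero. *)
  have [J cardJ /fintype.subsetP Jzero] : exists2 J : {set 'I_m2},
      #|J| = (n - m1 + 1)%N & J \subset [pred j | ((g j).@[u ord0] == 0)%R].
    by apply: subset_of_card; rewrite addn1.
  apply: (hRes_no_zero (res J cardJ)) => p.
  rewrite mem_cat => /orP[/codomP[i ->] //|/fintype.imageP[j jJ ->]].
  exact/eqP/Jzero.
- by move=> _ disc J cardJ; apply: hDisc_nonsingular; exact: disc.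
- exact: attains_min_closed_at_infty.
- exact: attains_min_unconstrained.
Qed.
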